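(* Let $\mathcal{O}$ be a finite set, let $M_\emptyset \succ 0$ and $M_u \succeq 0$ ($u \in \mathcal{O}$) be real symmetric matrices of the same size, and for $\mathcal{X} \subseteq \mathcal{O}$ let $$Y(\mathcal{X}) = \Big( M_\emptyset + \sum_{u \in \mathcal{X}} M_u \Big)^{-1}, \qquad t(\mathcal{X}) = \operatorname{Tr}[Y(\mathcal{X})].$$ Let $\mu_{\min}, \mu_{\max}$ be real numbers with $$0 < \mu_{\min} \leq \lambda_{\min}[M_\emptyset] \leq \lambda_{\max}\Big[ M_\emptyset + \sum_{u \in \mathcal{O}} M_u \Big] \leq \mu_{\max}.$$ Then $t$ is $\alpha$-supermodular for some $\alpha$ satisfying $$\alpha \geq \frac{\mu_{\min}}{\mu_{\max}} > 0.$$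
   Context: For a set function $f : 2^{\mathcal{O}} \to \mathbb{R}$ and $u \in \mathcal{O} \setminus \mathcal{X}$, let $\Delta_u f(\mathcal{X}) = f(\mathcal{X}) - f(\mathcal{X} \cup \{u\})$. For $\alpha \in \mathbb{R}$, $f$ is $\alpha$-supermodular if $\Delta_u f(\mathcal{A}) \geq \alpha\, \Delta_u f(\mathcal{B})$ for all $\mathcal{A} \subseteq \mathcal{B} \subseteq \mathcal{O}$ and all $u \in \mathcal{O} \setminus \mathcal{B}$. $\lambda_{\min}(\cdot)$ and $\lambda_{\max}(\cdot)$ denote the smallest and largest eigenvalues; $\succ 0$ and $\succeq 0$ denote positive definite and positive semidefinite. *)

(* Defs.v *)
From mathcomp Require Import all_boot all_order all_algebra sesquilinear.
From mathcomp Require Import boolp classical_sets reals.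

Set Implicit Arguments.
Unset Strict Implicit.
Unset Printing Implicit Defensive.

Import Order.TTheory GRing.Theory Num.Theory.

Local Open Scope ring_scope.

Section SetFunction.
Variables (R : realType) (O : finType).
Implicit Types (f : {set O} -> R) (A B X : {set O}) (u : O).

Definition set_decrement f u X : R := f X - f (u |: X).

Definition supermodular (alpha : R) f : Prop :=
  forall A B, A \subset B -> forall u, u \notin B ->
    alpha * set_decrement f u B <= set_decrement f u A.

End SetFunction.

Section SymmetricMatrix.
Variables (R : realType) (n : nat).
Implicit Types A : 'M[R]_n.

Definition posdefmx A : Prop :=
  A \is symmetricmx /\
  forall x : 'cV[R]_n, x != 0 -> 0 < (x^T *m A *m x) ord0 ord0.

Definition possemidefmx A : Prop :=
  A \is symmetricmx /\
  forall x : 'cV[R]_n, 0 <= (x^T *m A *m x) ord0 ord0.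

(* The spectrum of a matrix is finite, and nonempty if A is symmetric and
   n > 0; the infimum and supremum below are then a minimum and a maximum.
   They are 0 on an empty spectrum. *)
Definition lambda_min A : R := inf [set a : R | eigenvalue A a]%classic.

Definition lambda_max A : R := sup [set a : R | eigenvalue A a]%classic.

End SymmetricMatrix.

Section InverseTrace.
Variables (R : realType) (O : finType) (n : nat).
Variables (M0 : 'M[R]_n) (M : O -> 'M[R]_n).
Implicit Types X : {set O}.

Definition info_mx X : 'M[R]_n := M0 + \sum_(u in X) M u.

(* invmx is the identity on singular matrices, but info_mx X is positive
   definite as soon as M0 is and every M u is positive semidefinite. *)
Definition inv_info_mx X : 'M[R]_n := invmx (info_mx X).

Definition tr_inv_info X : R := \tr (inv_info_mx X).

End InverseTrace.

(* Main.v *)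
Require Import Defs.
From mathcomp Require Import classical_sets.
From mathcomp Require Import all_boot all_order all_algebra.
From mathcomp Require Import reals.
From mathcomp Require Import sesquilinear ring lra.

(** Why the bound holds.

    A positive semidefinite matrix is a sum of rank-one matrices v v^T, so the
    effect of adding D on the trace of the inverse telescopes into effects of
    rank-one updates (lemmas psd_rank1_ind and tr_invmx_supermodular).  It is
    therefore enough to compare rank-one updates of A and B, where A <= B in
    the Loewner order.

    With y = A^-1 v, the Sherman-Morrison formula gives
      tr A^-1 - tr (A + v v^T)^-1 = <y, y> / (1 + <y, A y>),
    since <v, y> = <y, A y>.  Write a = <v, A^-1 v> and b = <v, B^-1 v>.  If
    the spectra of A and B lie in [mu_min, mu_max], then <y, y> >= a / mu_max,
    while the corresponding numerator for B is at most b / mu_min.  Moreover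
    b <= a because inversion is antitone, and s / (1 + s) increases with s.
    Hence the decrement at A is at least
      (a / (1 + a)) / mu_max >= (b / (1 + b)) / mu_max,
    which is at least mu_min / mu_max times the decrement at B.

    The hypotheses on the extreme eigenvalues enter through the Loewner bounds
    lambda_min A <= A <= lambda_max A of a symmetric matrix A.  They are proved
    without diagonalisation: the largest s such that A - s is positive
    semidefinite has A - s singular, so it is an eigenvalue
    (lemma eigenvalue_lower_bound). *)

Set Implicit Arguments.
Unset Strict Implicit.
Unset Printing Implicit Defensive.

Import Order.TTheory GRing.Theory Num.Theory.

Local Open Scope ring_scope.

(** * The dot product of column vectors *)

Section DotProduct.
Variables (R : realType) (n : nat).
Implicit Types (x y z : 'cV[R]_n) (A : 'M[R]_n) (a : R).

Definition dot x y : R := (x^T *m y) ord0 ord0.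

Lemma dotE x y : dot x y = \sum_i x i ord0 * y i ord0.
Proof. by rewrite /dot mxE; apply: eq_bigr => i _; rewrite mxE. Qed.

Lemma dotC x y : dot x y = dot y x.
Proof. by rewrite !dotE; apply: eq_bigr => i _; rewrite mulrC. Qed.

Lemma dotr0 x : dot x 0 = 0.
Proof. by rewrite /dot mulmx0 mxE. Qed.

Lemma dotDr x y z : dot x (y + z) = dot x y + dot x z.
Proof. by rewrite /dot mulmxDr mxE. Qed.

Lemma dotZr a x y : dot x (a *: y) = a * dot x y.
Proof. by rewrite /dot -scalemxAr mxE. Qed.

Lemma dotBr x y z : dot x (y - z) = dot x y - dot x z.
Proof. by rewrite dotDr -scaleN1r dotZr mulN1r. Qed.

Lemma dotBl x y z : dot (x - y) z = dot x z - dot y z.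
Proof. by rewrite dotC dotBr !(dotC z). Qed.

Lemma dotZl a x y : dot (a *: x) y = a * dot x y.
Proof. by rewrite dotC dotZr dotC. Qed.

Lemma dot_mulmx A x y : dot x (A *m y) = dot (A^T *m x) y.
Proof. by rewrite /dot trmx_mul trmxK mulmxA. Qed.

Lemma dot_rank1 x y z : dot x ((y *m z^T) *m x) = dot x y * dot x z.
Proof.
rewrite (dotC x z) /dot -mulmxA mulmxA [LHS]mxE big_ord1.
by congr (_ * _); rewrite !mxE; apply: eq_bigr => i _; rewrite !mxE.
Qed.

Lemma mulmx_rank1 x y z : (x *m y^T) *m z = dot y z *: x.
Proof. by rewrite -mulmxA [y^T *m z]mx11_scalar mul_mx_scalar. Qed.

Lemma dot_ge0 x : 0 <= dot x x.
Proof. by rewrite dotE sumr_ge0 // => i _; rewrite -expr2 sqr_ge0. Qed.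

Lemma dot_gt0 x : x != 0 -> 0 < dot x x.
Proof.
move=> x0; rewrite lt_def dot_ge0 andbT; apply: contra x0.
rewrite dotE psumr_eq0 => [/allP h|i _]; last by rewrite -expr2 sqr_ge0.
apply/eqP/matrixP => i j; rewrite ord1 mxE; apply/eqP.
by have := h i (mem_index_enum i); rewrite mulf_eq0 orbb.
Qed.

(** The sum of the absolute values of the entries serves as a crude operator
    norm. *)
Lemma quad_bounded A :
  exists2 c, 0 < c & forall x, dot x (A *m x) <= c * dot x x.
Proof.
pose c := \sum_i \sum_j `|A i j|.
have c_ge0 : 0 <= c by apply: sumr_ge0 => i _; apply: sumr_ge0.
exists (c + 1) => [|x]; first lra.
suff : dot x (A *m x) <= c * dot x x by have := dot_ge0 x; lra.
rewrite [dot x (A *m x)]dotE /c mulr_suml ler_sum // => i _.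
rewrite mxE mulr_sumr mulr_suml ler_sum // => j _.
have sq k : x k ord0 ^+ 2 <= dot x x.
  rewrite dotE (bigD1 k) //= -expr2 lerDl sumr_ge0 // => l _.
  by rewrite -expr2 sqr_ge0.
rewrite mulrCA; apply: le_trans (ler_norm _) _; rewrite normrM.
apply: ler_wpM2l => //; rewrite normrM.
have := sq i; have := sq j; rewrite -(real_normK (num_real (x i ord0))).
rewrite -(real_normK (num_real (x j ord0))).
by have := sqr_ge0 (`|x i ord0| - `|x j ord0|); nra.
Qed.

End DotProduct.

(** * Positive semidefinite matrices *)

Section PositiveSemidefinite.
Variables (R : realType) (n : nat).
Implicit Types (x y v : 'cV[R]_n) (A B C : 'M[R]_n) (a : R).

Lemma symmetricmxE A : (A \is symmetricmx) = (A^T == A).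
Proof. by rewrite is_hermitianmxE expr0 scale1r map_mx_id // eq_sym. Qed.

Lemma psdP A :
  possemidefmx A <-> A^T = A /\ forall x, 0 <= dot x (A *m x).
Proof.
by split=> -[hs hp]; split; move: hs; rewrite ?symmetricmxE => /eqP // _ x;
  have := hp x; rewrite /dot mulmxA.
Qed.

Lemma psd0 : possemidefmx (0 : 'M[R]_n).
Proof. by apply/psdP; split=> [|x]; rewrite ?trmx0 // mul0mx dotr0. Qed.

Lemma psdD A B : possemidefmx A -> possemidefmx B -> possemidefmx (A + B).
Proof.
move=> /psdP[sA pA] /psdP[sB pB]; apply/psdP; split=> [|x].
  by rewrite linearD /= sA sB.
by rewrite mulmxDl dotDr addr_ge0.
Qed.

Lemma psd_sum (I : finType) (P : pred I) (F : I -> 'M[R]_n) :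
  (forall i, P i -> possemidefmx (F i)) -> possemidefmx (\sum_(i | P i) F i).
Proof. by move=> h; apply: big_ind => //; [exact: psd0|exact: psdD]. Qed.

Lemma psd_rank1 v : possemidefmx (v *m v^T).
Proof.
apply/psdP; split=> [|x]; first by rewrite trmx_mul trmxK.
by rewrite dot_rank1 -expr2 sqr_ge0.
Qed.

(** From the positivity of A at s x - t y, with s = <y, A y> and
    t = <x, A y>. *)
Lemma psd_CauchySchwarz A x y : possemidefmx A ->
  dot x (A *m y) ^+ 2 <= dot x (A *m x) * dot y (A *m y).
Proof.
move=> /psdP[sA pA].
have dotyx : dot y (A *m x) = dot x (A *m y).
  by rewrite dotC -{1}sA -dot_mulmx.
have comb s t : 0 <= s ^+ 2 * dot x (A *m x) - 2 * s * t * dot x (A *m y)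
                     + t ^+ 2 * dot y (A *m y).
  have := pA (s *: x - t *: y); rewrite mulmxBr -!scalemxAr.
  rewrite !(dotBl, dotBr, dotZl, dotZr) dotyx.
  lra.
have p_ge0 := pA x; have q_ge0 := pA y.
move: comb p_ge0 q_ge0.
set p := dot x (A *m x); set b := dot x (A *m y); set q := dot y (A *m y).
move=> comb p_ge0; rewrite le_eqVlt => /orP[/eqP q0|q_gt0].
  (* When y is isotropic, any t > p / 2 paired with s = b forces b = 0. *)
  by have := comb b (p + 1); rewrite -q0; have := sqr_ge0 b; nra.
have := comb q b; rewrite (_ : _ + _ = q * (p * q - b ^+ 2)); last by ring.
by rewrite pmulr_rge0 // subr_ge0.
Qed.

Lemma dot_delta i x : dot (delta_mx i ord0) x = x i ord0.
Proof.
rewrite dotE (bigD1 i) //= mxE !eqxx mul1r big1 ?addr0 // => j ji.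
by rewrite mxE (negPf ji) mul0r.
Qed.

Lemma dot_delta_mul A i j :
  dot (delta_mx i ord0) (A *m delta_mx j ord0) = A i j.
Proof. by rewrite dot_delta -colE mxE. Qed.

(** A positive semidefinite matrix is a sum of rank-one ones: this is symmetric
    Gaussian elimination.  Subtracting the square of the column of a positive
    diagonal entry, suitably normalised, clears the row and the column of that
    entry; Cauchy-Schwarz says that the difference is still positive
    semidefinite, and that a null diagonal entry already has a null row. *)
Lemma psd_rank1_ind (P : 'M[R]_n -> Prop) :
    P 0 ->
    (forall A v, possemidefmx A -> P A -> P (A + v *m v^T)) ->
  forall A, possemidefmx A -> P A.
Proof.
move=> P0 Prank1.
(* k counts the leading rows that elimination has yet to clear; each step
   clears row k.-1. *)
suff rows_ind k A : (forall i j : 'I_n, (k <= i)%N -> A i j = 0) ->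
    possemidefmx A -> P A.
  by move=> A; apply: (rows_ind n) => i j; rewrite leqNgt ltn_ord.
elim: k A => [|k IHk] A rowsA psdA.
  by suff -> : A = 0 by []; apply/matrixP => i j; rewrite mxE rowsA.
have [k_lt_n|n_le_k] := ltnP k n; last first.
  by apply: IHk => // i; rewrite leqNgt (leq_trans (ltn_ord i)).
pose o := Ordinal k_lt_n; have /psdP[symA posA] := psdA.
have CSo j : A o j ^+ 2 <= A o o * A j j.
  by rewrite -!dot_delta_mul; apply: psd_CauchySchwarz.
have := posA (delta_mx o ord0); rewrite dot_delta_mul.
rewrite le_eqVlt => /orP[/eqP Aoo0|Aoo_gt0].
  apply: IHk => // i j; rewrite leq_eqVlt => /orP[/eqP ki|]; last exact: rowsA.
  have -> : i = o by apply: val_inj.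
  apply/eqP; rewrite -sqrf_eq0 eq_le sqr_ge0 andbT.
  by have := CSo j; rewrite -Aoo0 mul0r.
pose v := (Num.sqrt (A o o))^-1 *: col o A.
have vvT : v *m v^T = (A o o)^-1 *: (col o A *m (col o A)^T).
  rewrite linearZ /= -scalemxAl -scalemxAr scalerA -invfM -expr2.
  by rewrite sqr_sqrtr // ltW.
have vvTE i j : (v *m v^T) i j = (A o o)^-1 * A i o * A j o.
  by rewrite vvT mxE [X in _ * X]mxE big_ord1 !mxE mulrA.
rewrite -(subrK (v *m v^T) A).
have psdAv : possemidefmx (A - v *m v^T).
  apply/psdP; split=> [|x].
    by rewrite linearB /= symA trmx_mul trmxK.
  rewrite mulmxBl dotBr subr_ge0 vvT -scalemxAl dotZr dot_rank1 -expr2.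
  rewrite ler_pdivrMl // [leRHS]mulrC colE -(dot_delta_mul A o o).
  exact: psd_CauchySchwarz.
apply: (Prank1) => //; apply: IHk => // i j.
have symAE p q : A p q = A q p by rewrite -{1}symA mxE.
rewrite [LHS]mxE [X in _ + X]mxE vvTE leq_eqVlt => /orP[/eqP ki|ki].
  have -> : i = o by apply: val_inj.
  by rewrite mulVf ?gt_eqF // mul1r (symAE j) subrr.
by rewrite !(rowsA i) // mulr0 mul0r subrr.
Qed.

End PositiveSemidefinite.

(** * The Loewner order *)

Definition psd_le (R : realType) (n : nat) (A B : 'M[R]_n) : Prop :=
  possemidefmx (B - A).

Section LoewnerOrder.
Variables (R : realType) (n : nat).
Implicit Types (x y v : 'cV[R]_n) (A B C D : 'M[R]_n) (a : R).

Lemma psd_le_quad A B x : psd_le A B -> dot x (A *m x) <= dot x (B *m x).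
Proof.
by move=> /psdP[_ /(_ x)]; rewrite mulmxBl dotBr subr_ge0.
Qed.

Lemma psd_leP A B : A^T = A -> B^T = B ->
  (forall x, dot x (A *m x) <= dot x (B *m x)) -> psd_le A B.
Proof.
move=> sA sB leAB; apply/psdP; split=> [|x]; first by rewrite linearB /= sA sB.
by rewrite mulmxBl dotBr subr_ge0.
Qed.

Lemma psd_le_trans A B C : psd_le A B -> psd_le B C -> psd_le A C.
Proof.
by move=> AB BC; rewrite /psd_le -(subrK B C) -addrA; exact: psdD.
Qed.

Lemma psd_le_addr A D : possemidefmx D -> psd_le A (A + D).
Proof. by rewrite /psd_le addrAC subrr add0r. Qed.

Lemma psd_le_add2r A B C : psd_le A B -> psd_le (A + C) (B + C).
Proof. by rewrite /psd_le opprD addrACA subrr addr0. Qed.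

Lemma dot_scalar a x : dot x (a%:M *m x) = a * dot x x.
Proof. by rewrite mul_scalar_mx dotZr. Qed.

Lemma scalar_psd_le a A : A^T = A ->
  (forall x, a * dot x x <= dot x (A *m x)) -> psd_le a%:M A.
Proof.
move=> sA leA; apply: psd_leP => // [|x]; first exact: tr_scalar_mx.
by rewrite dot_scalar.
Qed.

Lemma scalar_psd_le_scalar a b : a <= b -> psd_le a%:M (b%:M : 'M[R]_n).
Proof.
move=> leab; apply: scalar_psd_le => [|x]; first exact: tr_scalar_mx.
by rewrite dot_scalar ler_wpM2r // dot_ge0.
Qed.

Lemma psd_le_scalar_sym a A : psd_le a%:M A -> A^T = A.
Proof.
move=> /psdP[]; rewrite linearB /= tr_scalar_mx => /(congr1 (+%R^~ a%:M)).
by rewrite !subrK.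
Qed.

Lemma posdef_unitmx a A : 0 < a -> psd_le a%:M A -> A \in unitmx.
Proof.
move=> a_gt0 aA; rewrite unitmxE unitfE; apply/det0P => -[v v0 vA].
have vT0 : v^T != 0 by apply: contra v0 => /eqP h; rewrite -(trmxK v) h trmx0.
have := psd_le_quad v^T aA.
rewrite dot_scalar -{1}(psd_le_scalar_sym aA) -trmx_mul vA.
by rewrite trmx0 dotr0 leNgt mulr_gt0 // dot_gt0.
Qed.

(** Applied to x and C^-1 x, Cauchy-Schwarz reads
    <x, x>^2 <= <x, C x> <x, C^-1 x>, and the second factor is at most a
    multiple of <x, x>. *)
Lemma unitmx_posdef C : possemidefmx C -> C \in unitmx ->
  exists2 a, 0 < a & psd_le a%:M C.
Proof.
move=> psdC unitC; have /psdP[sC pC] := psdC.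
have [c c_gt0 invC_le] := quad_bounded (invmx C).
exists c^-1; rewrite ?invr_gt0 //; apply: scalar_psd_le => // x.
rewrite ler_pdivrMl //; have := invC_le x.
have := psd_CauchySchwarz x (invmx C *m x) psdC.
rewrite mulmxA mulmxV // mul1mx (dotC _ x); have := pC x; have := dot_ge0 x.
rewrite le_eqVlt => /orP[/eqP <- p _ _|]; first by rewrite mulr_ge0 // ltW.
move: (dot x x) (dot x (C *m x)) (dot x (invmx C *m x)) => s p q s_gt0 p_ge0.
move=> CS q_le; rewrite -(ler_pM2l s_gt0); nra.
Qed.

End LoewnerOrder.

(** * Extreme eigenvalues as Loewner bounds *)

Section RayleighBounds.
Variables (R : realType) (n : nat).
Implicit Types (A : 'M[R]_n.+1) (s t : R).

Lemma psd_le_eigenvalue A s t : psd_le s%:M A -> eigenvalue A t -> s <= t.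
Proof.
move=> sA /eigenvalueP[v vA v0].
have vT0 : v^T != 0 by apply: contra v0 => /eqP h; rewrite -(trmxK v) h trmx0.
have := psd_le_quad v^T sA.
rewrite dot_scalar -{1}(psd_le_scalar_sym sA) -trmx_mul vA.
by rewrite linearZ /= dotZr ler_pM2r // dot_gt0.
Qed.

(** The supremum s of the scalars below A is itself below A.  If A - s were
    invertible it would dominate some scalar a > 0, and s + a would be below
    A. *)
Lemma eigenvalue_lower_bound A : A^T = A ->
  exists2 s, eigenvalue A s & psd_le s%:M A.
Proof.
move=> sA; pose S := [set t : R | psd_le t%:M A]%classic.
have S0 : (S !=set0)%classic.
  have [c _ hc] := quad_bounded (- A); exists (- c).
  apply: scalar_psd_le => // x.
  have := hc x; rewrite mulNmx -scaleN1r dotZr; lra.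
have Sub : has_ubound S.
  exists (A ord0 ord0) => t /(psd_le_quad (delta_mx ord0 ord0)).
  by rewrite !dot_delta_mul mxE eqxx.
have supS : psd_le (sup S)%:M A.
  apply: scalar_psd_le => // x; have [->|x0] := eqVneq x 0.
    by rewrite mulmx0 dotr0 mulr0.
  rewrite -ler_pdivlMr ?dot_gt0 //; apply: ge_sup => // t /(psd_le_quad x).
  by rewrite dot_scalar ler_pdivlMr // dot_gt0.
exists (sup S) => //; rewrite /eigenvalue /eigenspace kermx_eq0 row_free_unit.
apply/negP => /(unitmx_posdef supS)[a a_gt0 aS].
have : sup S + a <= sup S.
  apply: ub_le_sup => //; rewrite /S /= /psd_le raddfD /=.
  by rewrite opprD addrA.
by rewrite gerDl leNgt a_gt0.
Qed.

(** An eigenvalue of A that is a Loewner lower bound of A also bounds the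
    spectrum from below, so the infimum defining lambda_min is under it. *)
Lemma lambda_min_psd_le A : A^T = A -> psd_le (lambda_min A)%:M A.
Proof.
move=> sA; have [s eigs sle] := eigenvalue_lower_bound sA.
apply: (psd_le_trans _ sle); apply: scalar_psd_le_scalar; apply: ge_inf => //.
by exists s => t; apply: psd_le_eigenvalue.
Qed.

Lemma psd_le_lambda_max A : A^T = A -> psd_le A (lambda_max A)%:M.
Proof.
move=> sA; have sNA : (- A)^T = - A by rewrite linearN /= sA.
have eigN t : eigenvalue (- A) (- t) = eigenvalue A t.
  apply/eigenvalueP/eigenvalueP => -[v vA v0]; exists v => //.
    by apply: oppr_inj; rewrite -mulmxN vA scaleNr.
  by rewrite mulmxN vA scaleNr.
have [s eigs sle] := eigenvalue_lower_bound sNA.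
have : psd_le A (- s)%:M by move: sle; rewrite /psd_le raddfN /= addrC.
move=> /psd_le_trans; apply; apply: scalar_psd_le_scalar; apply: ub_le_sup.
  by exists (- s) => t /=; rewrite -eigN => /(psd_le_eigenvalue sle); lra.
by rewrite /= -eigN opprK.
Qed.

End RayleighBounds.

(** * Rank-one updates of the inverse *)

Section RankOneUpdate.
Variables (R : realType) (n : nat).
Implicit Types (v x : 'cV[R]_n) (A B C D : 'M[R]_n).

(** The Sherman-Morrison formula for a symmetric update. *)
Lemma invmx_rank1_update A v : A^T = A -> A \in unitmx ->
    let y := invmx A *m v in 1 + dot v y != 0 ->
  invmx (A + v *m v^T) = invmx A - (1 + dot v y)^-1 *: (y *m y^T).
Proof.
move=> sA unitA y d0; set Z := _ - _.
have AZ1 : (A + v *m v^T) *m Z = 1%:M.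
  have AyyT : A *m (y *m y^T) = v *m y^T by rewrite !mulmxA mulmxV // mul1mx.
  have vvTinvA : v *m v^T *m invmx A = v *m y^T.
    by rewrite -mulmxA trmx_mul trmx_inv sA.
  have vvTyyT : v *m v^T *m (y *m y^T) = dot v y *: (v *m y^T).
    by rewrite mulmxA mulmx_rank1 -scalemxAl.
  rewrite mulmxBr mulmxDl mulmxV // vvTinvA -scalemxAr mulmxDl AyyT vvTyyT.
  by rewrite -[X in X + _ *: _]scale1r -scalerDl scalerA mulVf // scale1r addrK.
have [unitU _] := mulmx1_unit AZ1.
by rewrite -[LHS]mulmx1 -AZ1 mulmxA mulVmx // mul1mx.
Qed.

Lemma dot_invmx_ge0 A v : possemidefmx A -> A \in unitmx ->
  0 <= dot v (invmx A *m v).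
Proof.
move=> /psdP[_ pA] unitA; have := pA (invmx A *m v).
by rewrite mulmxA mulmxV // mul1mx dotC.
Qed.

(** With y = A^-1 v and z = B^-1 v, both sides are the energies <y, A y> and
    <z, B z>, and <z, B z> = <z, v> = <z, A y>, which Cauchy-Schwarz for A
    bounds by the geometric mean of <y, A y> and <z, A z> <= <z, B z>. *)
Lemma dot_invmx_antitone A B v : possemidefmx A -> psd_le A B ->
    A \in unitmx -> B \in unitmx ->
  dot v (invmx B *m v) <= dot v (invmx A *m v).
Proof.
move=> psdA leAB unitA unitB.
have psdB : possemidefmx B by rewrite -(subrK A B); apply: psdD.
have := psd_CauchySchwarz (invmx B *m v) (invmx A *m v) psdA.
have := psd_le_quad (invmx B *m v) leAB.
rewrite !mulmxA !mulmxV // !mul1mx !(dotC _ v).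
have := dot_invmx_ge0 v psdA unitA; have := dot_invmx_ge0 v psdB unitB.
move: (dot _ (_ *m v)) (dot v _) (dot v _) => b a q.
nra.
Qed.

Lemma tr_invmx_rank1_update A v : possemidefmx A -> A \in unitmx ->
  let y := invmx A *m v in
  \tr (invmx A) - \tr (invmx (A + v *m v^T)) = dot y y / (1 + dot v y).
Proof.
move=> psdA unitA y; have [sA _] := (psdP A).1 psdA.
have y_ge0 := dot_invmx_ge0 v psdA unitA.
rewrite invmx_rank1_update // ?gt_eqF ?ltr_wpDr // linearB linearZ /=.
by rewrite mxtrace_mulC trace_mx11 opprB addrC subrK mulrC.
Qed.

End RankOneUpdate.

(** * Decrements of the trace of the inverse *)

Section TraceMarginals.
Variables (R : realType) (n : nat) (m p : R).
Hypothesis m_gt0 : 0 < m.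
Implicit Types (v x : 'cV[R]_n) (A B C D : 'M[R]_n).

Lemma psd_of_scalar_le A : psd_le m%:M A -> possemidefmx A.
Proof.
move=> mA; rewrite -(subrK m%:M A); apply: psdD => //.
apply/psdP; split=> [|x]; first exact: tr_scalar_mx.
by rewrite dot_scalar mulr_ge0 ?dot_ge0 // ltW.
Qed.

(** Both sides are compared with s / (1 + s), taken at s = <v, B^-1 v> on the
    left and at the larger s = <v, A^-1 v> on the right.  The scalar bounds
    apply to the vectors A^-1 v and B^-1 v, for which <y, A y> = <v, A^-1 v>. *)
Lemma tr_invmx_rank1_supermodular A B v :
    psd_le m%:M A -> psd_le A B -> psd_le B p%:M ->
  m * (\tr (invmx B) - \tr (invmx (B + v *m v^T))) <=
    p * (\tr (invmx A) - \tr (invmx (A + v *m v^T))).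
Proof.
move=> mA AB Bp; have mB := psd_le_trans mA AB; have Ap := psd_le_trans AB Bp.
have [psdA psdB] := (psd_of_scalar_le mA, psd_of_scalar_le mB).
have [unitA unitB] := (posdef_unitmx m_gt0 mA, posdef_unitmx m_gt0 mB).
rewrite !tr_invmx_rank1_update //.
have := psd_le_quad (invmx A *m v) Ap; have := psd_le_quad (invmx B *m v) mB.
rewrite !dot_scalar !mulmxA !mulmxV // !mul1mx !(dotC _ v).
have := dot_invmx_antitone v psdA AB unitA unitB.
have := dot_invmx_ge0 v psdB unitB.
(* a = <v, A^-1 v> and b = <v, B^-1 v>; yy and zz are the squared norms of
   A^-1 v and B^-1 v. *)
move: (dot v _) (dot v _) => a b.
move: (dot _ _) (dot _ _) => yy zz b_ge0 leba le_mzz_b le_a_pyy.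
have [a1_gt0 b1_gt0] : 0 < 1 + a /\ 0 < 1 + b by split; lra.
apply: (@le_trans _ _ (b / (1 + b))).
  by rewrite mulrA ler_pM2r // invr_gt0.
apply: (@le_trans _ _ (a / (1 + a))).
  by rewrite ler_pdivrMr // mulrAC ler_pdivlMr //; lra.
by rewrite mulrA ler_pM2r // invr_gt0.
Qed.

(** Adding the rank-one terms of D one at a time to A and B keeps A + D' below
    B + D' and both within the scalar bounds, so that each step falls under the
    rank-one case. *)
Lemma tr_invmx_supermodular D : possemidefmx D -> forall A B,
    psd_le m%:M A -> psd_le A B -> psd_le (B + D) p%:M ->
  m * (\tr (invmx B) - \tr (invmx (B + D))) <=
    p * (\tr (invmx A) - \tr (invmx (A + D))).
Proof.
move: D; apply: psd_rank1_ind => [|D v psdD IH] A B mA AB Bp.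
  by rewrite !addr0 !subrr !mulr0.
move: Bp; rewrite !addrA => Bp.
have BDp : psd_le (B + D) p%:M.
  by apply: psd_le_trans Bp; apply/psd_le_addr/psd_rank1.
have step1 := IH A B mA AB BDp.
have mAD : psd_le m%:M (A + D) by apply: psd_le_trans mA (psd_le_addr _ psdD).
have step2 := tr_invmx_rank1_supermodular v mAD (psd_le_add2r D AB) BDp.
by have := lerD step1 step2; rewrite -!mulrDr !addrA !subrK.
Qed.

End TraceMarginals.

Theorem theorem3 (R : realType) (O : finType) (n : nat)
    (M0 : 'M[R]_n.+1) (M : O -> 'M[R]_n.+1) (mu_min mu_max : R)
    (hM0 : posdefmx M0)
    (hM : forall u : O, possemidefmx (M u))
    (hmu_min_gt0 : 0 < mu_min)
    (hmu_min : mu_min <= lambda_min M0)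
    (hlambda : lambda_min M0 <= lambda_max (M0 + \sum_(u : O) M u))
    (hmu_max : lambda_max (M0 + \sum_(u : O) M u) <= mu_max) :
  exists alpha : R,
    [/\ supermodular alpha (tr_inv_info M0 M),
        mu_min / mu_max <= alpha
      & 0 < mu_min / mu_max].
Proof.
have mu_max_gt0 : 0 < mu_max by lra.
exists (mu_min / mu_max); split=> //; last exact: divr_gt0.
have sM0 : M0^T = M0 by case: hM0 => + _; rewrite symmetricmxE => /eqP.
have info_mono (X Y : {set O}) : X \subset Y ->
    psd_le (info_mx M0 M X) (info_mx M0 M Y).
  move=> sXY; rewrite /psd_le /info_mx (big_setID X) /= (setIidPr sXY).
  by rewrite opprD addrACA subrr add0r addrAC subrr add0r; apply: psd_sum.
have low X : psd_le mu_min%:M (info_mx M0 M X).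
  apply: psd_le_trans (psd_le_addr _ (psd_sum _)) => //.
  exact: psd_le_trans (scalar_psd_le_scalar _ hmu_min) (lambda_min_psd_le sM0).
have info_setT : info_mx M0 M [set: O] = M0 + \sum_(u : O) M u.
  by rewrite /info_mx; congr (_ + _); apply: eq_bigl => u; rewrite inE.
have high X : psd_le (info_mx M0 M X) mu_max%:M.
  apply: psd_le_trans (info_mono _ _ (subsetT X)) _; rewrite info_setT.
  apply: psd_le_trans (scalar_psd_le_scalar _ hmu_max).
  apply: psd_le_lambda_max; rewrite -info_setT.
  exact: psd_le_scalar_sym (low _).
have infoU u (X : {set O}) : u \notin X ->
    info_mx M0 M (u |: X) = info_mx M0 M X + M u.
  by move=> uX; rewrite /info_mx big_setU1 //= addrCA addrC.
move=> A B sAB u uB.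
have uA : u \notin A by apply: contra uB; apply: (subsetP sAB).
rewrite /set_decrement /tr_inv_info /inv_info_mx !infoU //.
rewrite mulrAC ler_pdivrMr // [leRHS]mulrC; apply: tr_invmx_supermodular => //.
- exact: info_mono.
- by rewrite -infoU.
Qed.
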